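(* Let $\mathcal{H}$ be a Hilbert space, $V$ a Banach space, $A\in\mathcal{L}(\mathcal{H},V)$ a linear and continuous operator, and $A^*\in\mathcal{L}(V',\mathcal{H})$ its adjoint. Assume that for an orthogonal projection $P\colon\mathcal{H}\to\mathcal{H}$ there exists a constant $\varepsilon>0$ such that $$\|A(f-Pf)\|_V\le \varepsilon\,\|f\|_{\mathcal{H}}\qquad\text{for all } f\in\mathcal{H}.$$ Let $\theta\in(0,1)$ and let $v\in(\mathcal{H},A^*(V'))_{\theta,\infty}$. Then $$\|v-Pv\|_{\mathcal{H}}\le \|v\|_{(\mathcal{H},A^*(V'))_{\theta,\infty}}\cdot\varepsilon^{\theta}.$$
   Context: $\mathcal{L}(V,W)$ denotes the space of bounded linear operators between Banach spaces $V$ and $W$; $V'$ is the (continuous) dual of $V$. All spaces are over $\mathbb{R}$. The adjoint $A^*\colon V'\to\mathcal{H}$ is defined by $\langle A^*g,f\rangle_{\mathcal{H}}=g(Af)$ for all $f\in\mathcal{H}$, $g\in V'$. The range $A^*(V')\subset\mathcal{H}$ is equipped with the norm $\|v\|_{A^*(V')}:=\inf\{\|g\|_{V'} : g\in V',\ v=A^*g\}$. Real interpolation: for a Banach space $(\mathcal{K},\|\cdot\|_{\mathcal{K}})$ that is a subspace of $\mathcal{H}$, $f\in\mathcal{H}$ and $t>0$, set $K(t,f):=\inf_{v\in\mathcal{K}}\left(\|f-v\|_{\mathcal{H}}+t\|v\|_{\mathcal{K}}\right)$. For $\theta\in(0,1)$ define $\|f\|_{(\mathcal{H},\mathcal{K})_{\theta,\infty}}:=\sup_{t>0}t^{-\theta}K(t,f)$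 and $(\mathcal{H},\mathcal{K})_{\theta,\infty}:=\{f\in\mathcal{H}:\|f\|_{(\mathcal{H},\mathcal{K})_{\theta,\infty}}<\infty\}$. *)

(* Defs.v *)
From mathcomp Require Import all_boot all_order all_algebra.
From mathcomp Require Import all_classical all_reals all_analysis.
Import Order.TTheory GRing.Theory Num.Theory.
Import numFieldNormedType.Exports.

Set Implicit Arguments.
Unset Strict Implicit.
Unset Printing Implicit Defensive.

Local Open Scope classical_set_scope.
Local Open Scope ring_scope.

(* A Banach space is a [completeNormedModType R]. A real Hilbert space is a
   Banach space H with a symmetric positive definite form
   [dot : {dot H for idfun}] that induces its norm. *)
Definition induces_norm (R : realType) (H : normedModType R)
    (dot : {dot H for (@idfun R)}) : Prop :=
  forall f : H, `|f| = Num.sqrt (dot f f).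

Definition orthogonal_projection (R : realType) (H : normedModType R)
    (dot : {dot H for (@idfun R)}) (P : {linear H -> H}) : Prop :=
  (forall f : H, P (P f) = P f) /\ (forall f g : H, dot (P f) g = dot f (P g)).

Record dual (R : realType) (V : normedModType R) := Dual {
  dual_fun :> {scalar V};
  dual_continuous : continuous (dual_fun : V -> R)
}.

Definition dual_norm (R : realType) (V : normedModType R) (g : dual V) : R :=
  sup [set `|g x| | x in [set x : V | `|x| <= 1]].

(* By the Riesz representation theorem, a continuous A has exactly one adjoint
   when H is complete; it is linear and bounded. *)
Definition is_adjoint (R : realType) (H V : normedModType R)
    (dot : {dot H for (@idfun R)}) (A : {linear H -> V})
    (Astar : dual V -> H) : Prop :=
  forall (g : dual V) (f : H), dot (Astar g) f = g (A f).

(* Only meaningful for v in [range Astar]: [inf] is 0 on the empty set. *)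
Definition adjoint_range_norm (R : realType) (H V : normedModType R)
    (Astar : dual V -> H) (v : H) : R :=
  inf [set dual_norm g | g in [set g : dual V | v = Astar g]].

(* In the next three definitions the subspace of H is the set K, normed by the
   restriction of normK to K; the values of normK outside K play no role. *)
Definition K_functional (R : realType) (H : normedModType R)
    (K : set H) (normK : H -> R) (t : R) (f : H) : R :=
  inf [set `|f - v| + t * normK v | v in K].

Definition interpolation_norm (R : realType) (H : normedModType R)
    (K : set H) (normK : H -> R) (theta : R) (f : H) : \bar R :=
  ereal_sup [set (t `^ (- theta) * K_functional K normK t f)%:E
            | t in [set t : R | 0 < t]].

Definition interpolation_space (R : realType) (H : normedModType R)
    (K : set H) (normK : H -> R) (theta : R) : set H :=
  [set f | (interpolation_norm K normK theta f < +oo)%E].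

(* Main.v *)
Require Import Defs.
From mathcomp Require Import all_boot all_order all_algebra.
From mathcomp Require Import all_classical all_reals all_analysis.
Import Order.TTheory GRing.Theory Num.Theory.
Import numFieldNormedType.Exports.
Local Open Scope classical_set_scope.
Local Open Scope ring_scope.

(* Write Q = id - P. For w = A* g in the range of the adjoint,
   |Q w|^2 = <A* g, Q w> = g (A (Q (Q w))) <= |g| eps |Q w|, so |Q w| is at
   most eps times the range norm of w. Since Q is a contraction, splitting
   v = (v - w) + w and taking the infimum over w gives |Q v| <= K(eps, v), and
   K(eps, v) is at most eps^theta times the interpolation norm of v. *)

Lemma dual_norm_bound {R : realType} {V : normedModType R} (g : dual V)
    (x : V) : `|g x| <= dual_norm g * `|x|.
Proof.
(* Continuity provides [M], which bounds the set defining [dual_norm g], so its [sup] is a genuine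
   upper bound and not the default value 0. *)
have [M gM] : exists M, forall y : V, `|g y| <= M * `|y|.
  have /linear_boundedP/pinfty_ex_gt0[M _ gM] :
      bounded_near (dual_fun g : V -> R^o) (nbhs (0 : V)).
    by apply: continuous_linear_bounded; exact: dual_continuous.
  by exists M.
have [->|x0] := eqVneq x 0; first by rewrite linear0 !normr0 mulr0.
have nx : 0 < `|x| by rewrite normr_gt0.
rewrite -ler_pdivrMr// mulrC.
have -> : `|x|^-1 * `|g x| = `|g (`|x|^-1 *: x)|.
  by rewrite linearZ/= normrM normfV normr_id.
apply: ub_le_sup.
  exists `|M| => _ [y /= y1 <-].
  apply: le_trans (gM y) _.
  apply: le_trans (_ : `|M| * `|y| <= _); first by rewrite ler_wpM2r// ler_norm.
  by rewrite -[leRHS]mulr1 ler_wpM2l.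
exists (`|x|^-1 *: x) => //=.
by rewrite normrZ normfV normr_id mulVf// gt_eqF.
Qed.

Lemma dual_norm_ge0 {R : realType} {V : normedModType R} (g : dual V) :
  0 <= dual_norm g.
Proof.
rewrite /dual_norm; set S := [set _ | _ in _].
(* [sup] defaults to 0 on a set without a supremum; otherwise it dominates the member [|g 0|]. *)
have [[_ ubS]|/sup_out->//] := pselect (has_sup S).
apply: le_trans (ub_le_sup ubS (_ : S `|g 0|)) => //.
by exists 0; rewrite //= normr0.
Qed.

(** Provides an element of [dual V], so that [range Astar] is nonempty and the infimum in the
    K-functional is not the default 0. *)
Lemma continuous_null_functional (R : realType) (V : normedModType R) :
  continuous ((\0 : {scalar V}) : V -> R).
Proof. by move=> x; exact: cst_continuous. Qed.

Section OrthogonalProjection.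
Context {R : realType} {H : normedModType R} (dot : {dot H for (@idfun R)}).
Context (P : {linear H -> H}).
Hypotheses (hdot : induces_norm dot) (hP : orthogonal_projection dot P).

Lemma dot_ge0 (f : H) : 0 <= dot f f.
Proof.
have [->|f0] := eqVneq f 0; first by rewrite linear0l.
exact/ltW/neq0_dnorm_gt0.
Qed.

Lemma dot_norm (f : H) : dot f f = `|f| ^+ 2.
Proof. by rewrite hdot sqr_sqrtr// dot_ge0. Qed.

(* [linearBl] and [linearBr] leave a form of [dot f g] that blocks later rewriting. *)
Lemma dotBl (f g h : H) : dot (f - g) h = dot f h - dot g h.
Proof. exact: linearBl. Qed.

Lemma dotBr (f g h : H) : dot f (g - h) = dot f g - dot f h.
Proof. exact: linearBr. Qed.

Lemma dot_complement (f g : H) : dot (f - P f) g = dot f (g - P g).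
Proof. by rewrite dotBl dotBr hP.2. Qed.

Lemma complement_idem (f : H) : f - P f - P (f - P f) = f - P f.
Proof. by rewrite linearB/= hP.1 subrr subr0. Qed.

(** [id - P] is self-adjoint and idempotent, so one of the two factors in the squared norm can be
    absorbed into the other. *)
Lemma sqr_norm_complement (f : H) : `|f - P f| ^+ 2 = dot f (f - P f).
Proof. by rewrite -dot_norm dot_complement complement_idem. Qed.

Lemma norm_complement_le (f : H) : `|f - P f| <= `|f|.
Proof.
rewrite -ler_sqr ?nnegrE// sqr_norm_complement dotBr dot_norm gerBl.
(* The subtracted term [dot f (P f)] equals [dot (P f) (P f)]. *)
by rewrite -hP.1 -hP.2 dot_ge0.
Qed.

Variables (V : normedModType R) (A : {linear H -> V}) (Astar : dual V -> H).
Hypothesis hAstar : is_adjoint dot A Astar.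
Variable eps : R.
Hypothesis eps_gt0 : 0 < eps.
Hypothesis hAP : forall f : H, `|A (f - P f)| <= eps * `|f|.

Lemma norm_complement_adjoint_le (g : dual V) :
  `|Astar g - P (Astar g)| <= eps * dual_norm g.
Proof.
set q := Astar g - P (Astar g).
have [->|q0] := eqVneq q 0.
  by rewrite normr0 mulr_ge0 ?dual_norm_ge0// ltW.
have nq : 0 < `|q| by rewrite normr_gt0.
rewrite -(ler_pM2r nq) -expr2 sqr_norm_complement hAstar.
apply: (le_trans (ler_norm _)); apply: (le_trans (dual_norm_bound _ _)).
rewrite -/q -mulrA mulrCA ler_wpM2l ?dual_norm_ge0//.
(* Applying [hAP] to [q] itself, which [id - P] fixes, yields the factor [|q|] that cancels one
   power of the squared norm. *)
by have := hAP q; rewrite complement_idem.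
Qed.

(** The preceding bound holds for every preimage of [w]; after division by [eps] it is a lower bound
    that passes to the infimum. *)
Lemma norm_complement_range_le (w : H) : range Astar w ->
  `|w - P w| <= eps * adjoint_range_norm Astar w.
Proof.
move=> [g _ gw]; rewrite mulrC -ler_pdivrMr//; apply: lb_le_inf.
  by exists (dual_norm g); exists g.
move=> _ [h /= -> <-].
by rewrite ler_pdivrMr// mulrC norm_complement_adjoint_le.
Qed.

Lemma norm_complement_le_K_functional (v : H) :
  `|v - P v| <= K_functional (range Astar) (adjoint_range_norm Astar) eps v.
Proof.
apply: lb_le_inf.
  apply: image_nonempty; exists (Astar (Dual (continuous_null_functional R V))).
  by eexists.
move=> _ [w wK <-].
have -> : v - P v = (v - w - P (v - w)) + (w - P w).
  by rewrite linearB/= addrACA subrK -opprD subrK.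
apply: le_trans (ler_normD _ _) _.
by rewrite lerD ?norm_complement_le// norm_complement_range_le.
Qed.

End OrthogonalProjection.

(** The weighted value at [t] is one member of the supremum, and the factor [t ^ theta] undoes the
    weight. *)
Lemma K_functional_le_interpolation_norm {R : realType} {H : normedModType R}
    (K : set H) (normK : H -> R) (theta t : R) (f : H) : 0 < t ->
  ((K_functional K normK t f)%:E
     <= interpolation_norm K normK theta f * (t `^ theta)%:E)%E.
Proof.
move=> t0.
have -> : K_functional K normK t f
    = t `^ (- theta) * K_functional K normK t f * t `^ theta.
  by rewrite mulrAC powRN mulVf ?mul1r// gt_eqF// powR_gt0.
rewrite EFinM lee_wpmul2r ?lee_fin ?powR_ge0//.
by apply: ereal_sup_ubound; exists t.
Qed.

Theorem corollary10 (R : realType) (H V : completeNormedModType R)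
    (dot : {dot H for (@idfun R)}) (hdot : induces_norm dot)
    (A : {linear H -> V}) (hA : continuous A)
    (Astar : dual V -> H) (hAstar : is_adjoint dot A Astar)
    (P : {linear H -> H}) (hP : orthogonal_projection dot P)
    (eps : R) (heps : 0 < eps)
    (hAP : forall f : H, `|A (f - P f)| <= eps * `|f|)
    (theta : R) (htheta0 : 0 < theta) (htheta1 : theta < 1)
    (v : H)
    (hv : interpolation_space (range Astar) (adjoint_range_norm Astar) theta v) :
  (`|v - P v|%:E
     <= interpolation_norm (range Astar) (adjoint_range_norm Astar) theta v
        * (eps `^ theta)%:E)%E.
Proof.
apply: le_trans (K_functional_le_interpolation_norm _ _ _ _ _ heps).
by rewrite lee_fin; exact: norm_complement_le_K_functional.
Qed.
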